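(* Let $D\subset\mathbb{R}^n$ be a domain with $0\in D$ and let $f\in\mathcal{C}(D,\mathbb{R}^n)$ be locally Lipschitz with $f(0)=0$. Consider the system $\Sigma_{f,D}$ with flow $\pi$: $\partial_t\pi(t,x_0)=f(\pi(t,x_0))$, $\pi(0,x_0)=x_0$, and suppose that: (1) the equilibrium point $x=0$ is asymptotically stable with region of attraction $\mathcal{R}\subset D$; (2) $f\in\mathcal{C}^1(\mathcal{R})$ and there exists a neighborhood $\mathcal{N}\subset\mathcal{R}$ of $x=0$ such that $f\in\mathcal{C}^3(\mathcal{N})$; (3) the Jacobian $Df(0)$ is Hurwitz, i.e. all its eigenvalues have negative real part. Let $\Omega\subset\mathcal{R}$ be a compact subset with $0\in\Omega$. If $(\mathcal{F},\mathcal{V},\mathcal{P})_\Omega$ is jointly universally approximating, then for any $\varepsilon>0$ there exists $(\tilde f,\hat V,\hat\omega)\in(\mathcal{F},\mathcal{V},\mathcal{P})_\Omega$ such that $\hat f\triangleq\mathcal{G}_\Omega(\tilde f,\hat V,\hat\omega)$ is in $\mathcal{C}(\Omega,\mathbb{R}^n)$ and satisfies $$\|f-\hat f\|_{\mathcal{C}(\Omega)}\le\varepsilon.$$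
   Context: Stability: $0$ is stable if for every $\varepsilon>0$ there is $\delta>0$ such that $\|x_0\|<\delta$ implies $\|\pi(t,x_0)\|<\varepsilon$ for all $t\ge0$; asymptotically stable if stable and $\delta$ can be chosen such that $\|x_0\|<\delta$ implies $\pi(t,x_0)\to0$. The region of attraction is $\mathcal{R}=\{x_0\in D\mid\lim_{t\to\infty}\pi(t,x_0)=0\}$. Norms: $\|g\|_{\mathcal{C}^k(\Omega)}=\max_{|\alpha|\le k}\sup_{x\in\Omega}\|D^\alpha g(x)\|$ ($\alpha$ a multiindex), $\mathcal{C}=\mathcal{C}^0$. Classes: $\mathcal{F}_\Omega,\mathcal{V}_\Omega,\mathcal{P}_\Omega$ are given classes of functions (realized by neural network architectures) on $\mathbb{R}^n$ whose members satisfy the following class conditions. Class $\mathcal{F}$: $\tilde f:\mathbb{R}^n\to\mathbb{R}^n$, $\tilde f\in\mathcal{C}(\Omega,\mathbb{R}^n)$, $\tilde f(0)=0$. Class $\mathcal{V}$: $\hat V:\mathbb{R}^n\to\mathbb{R}$, $\hat V\in\mathcal{C}^1(\Omega,\mathbb{R})$, and for all $x\in\Omega$, $\nabla\hat V(x)=0\iff x=0$. Class $\mathcal{P}$: $\hat\omega:\mathbb{R}^n\to\mathbb{R}$, $\hat\omega\in\mathcal{C}(\Omega,\mathbb{R})$, $\hat\omega(0)=0$. The triple $(\mathcal{F},\mathcal{V},\mathcal{P})_\Omega$ is jointly universally approximating if for every $g\in\mathcal{C}(\Omega,\mathbb{R}^n)$, $V\in\mathcal{C}^1(\Omega,\mathbb{R})$,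 $\omega\in\mathcal{C}(\Omega,\mathbb{R})$ satisfying the respective class conditions ($g(0)=0$; $\nabla V(x)=0\iff x=0$ on $\Omega$; $\omega(0)=0$) and every $\delta>0$, there exist $\tilde f\in\mathcal{F}_\Omega$, $\hat V\in\mathcal{V}_\Omega$, $\hat\omega\in\mathcal{P}_\Omega$ with $\|g-\tilde f\|_{\mathcal{C}(\Omega)}\le\delta$, $\|V-\hat V\|_{\mathcal{C}^1(\Omega)}\le\delta$, $\|\omega-\hat\omega\|_{\mathcal{C}(\Omega)}\le\delta$. Generated model: with $\hat W=\nabla\hat V$ and $\hat v(x)=\hat W(x)/\|\hat W(x)\|$ if $\hat W(x)\neq0$, $\hat v(x)=0$ otherwise, $\mathcal{G}_\Omega(\tilde f,\hat V,\hat\omega)$ is the function $\hat f:\Omega\to\mathbb{R}^n$ given by $\hat f=\tilde f-\hat v\hat v^\top\tilde f+\hat v\,(-\hat\omega(1-\hat V^2))$. *)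

(* Defs.v *)
From HB Require Import structures.
From mathcomp Require Import all_boot all_order all_algebra.
From mathcomp Require Import all_classical all_reals all_analysis.
From mathcomp Require Import complex.
Set Implicit Arguments.
Unset Strict Implicit.
Unset Printing Implicit Defensive.
Import Order.TTheory GRing.Theory Num.Theory.
Import numFieldNormedType.Exports.

Local Open Scope classical_set_scope.
Local Open Scope ring_scope.

(* Points of R^n are row vectors. The norm `|x| that the library puts on
   matrices is the max norm, so the Euclidean norm of R^n is defined here; the
   two norms induce the same topology, the same differentiability and the same
   (locally) Lipschitz functions. *)
Definition enorm (R : realType) n (x : 'rV[R]_n) : R :=
  Num.sqrt (\sum_i x 0 i ^+ 2).

Section smoothness.
Variables (R : realType) (n : nat) (W : normedModType R).
Implicit Types (g : 'rV[R]_n -> W) (U A : set 'rV[R]_n).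

Definition partial (i : 'I_n) g : 'rV[R]_n -> W :=
  fun x => 'D_(delta_mx 0 i) g x.

Definition multi_partial (a : 'I_n -> nat) g : 'rV[R]_n -> W :=
  foldr (fun i h => iter (a i) (partial i) h) g (enum 'I_n).

(* All iterated partial derivatives of order at most k exist and are
   continuous; meant for open U. *)
Fixpoint Ck_open (k : nat) U g : Prop :=
  {within U, continuous g} /\
  (if k is k'.+1 then
     forall i : 'I_n,
       (forall x, U x -> derivable g x (delta_mx 0 i)) /\
       Ck_open k' U (partial i g)
   else True).

(* For k >= 1 and a set A that need not be open: C^k on an open neighbourhood
   of A, so that the derivatives of the (total) function g at points of A
   are determined. When A is open this is C^k on A. Continuity on A is
   {within A, continuous g}. *)
Definition Ck (k : nat) A g : Prop :=
  exists U, [/\ open U, A `<=` U & Ck_open k U g].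

(* || g ||_{C^k(A)} in [0, +oo], for N the norm of the codomain; the index
   set is that of the multiindices a with |a| <= k. *)
Definition Ck_norm (N : W -> R) (k : nat) A g : \bar R :=
  (\big[maxe/0%:E]_(a : {ffun 'I_n -> 'I_k.+1} | (\sum_i a i <= k)%N)
     ereal_sup [set (N (multi_partial (fun i => a i : nat) g x))%:E | x in A])%E.

End smoothness.

Definition grad (R : realType) n (V : 'rV[R]_n -> R) (x : 'rV[R]_n)
    : 'rV[R]_n :=
  \row_i partial (i : 'I_n) (V : _ -> R^o) x.

Definition Hurwitz (R : realType) n (A : 'M[R]_n) : Prop :=
  forall z : R[i], eigenvalue (map_mx (real_complex R) A) z ->
    complex.Re z < 0.

Section dynamics.
Variables (R : realType) (n : nat).
Implicit Types (D : set 'rV[R]_n) (f : 'rV[R]_n -> 'rV[R]_n).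

Definition is_domain D : Prop := [/\ open D, connected D & D !=set0].

Definition locally_lipschitz D f : Prop :=
  forall x, D x -> exists2 U, nbhs x U & [lipschitz f y | y in D `&` U].

Definition is_solution D f (x0 : 'rV[R]_n) (J : set R)
    (phi : R -> 'rV[R]_n) : Prop :=
  [/\ open J, is_interval J, J 0, phi 0 = x0 &
      forall t, J t -> D (phi t) /\ is_derive t 1 phi (f (phi t))].

(* pi ^~ x0 is a non-extendable solution on the interval of existence J x0;
   the values of pi t x0 for t outside J x0 or x0 outside D are irrelevant. *)
Definition is_flow D f (J : 'rV[R]_n -> set R)
    (pi : R -> 'rV[R]_n -> 'rV[R]_n) : Prop :=
  forall x0, D x0 ->
    is_solution D f x0 (J x0) (pi ^~ x0) /\
    (forall K phi, is_solution D f x0 K phi -> J x0 `<=` K ->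
       (forall t, J x0 t -> phi t = pi t x0) -> K `<=` J x0).

Section stability.
Variables (D : set 'rV[R]_n) (J : 'rV[R]_n -> set R).
Variable pi : R -> 'rV[R]_n -> 'rV[R]_n.

(* A claim about pi t x0 for all t >= 0 includes that the solution exists
   for all t >= 0. *)
Definition converges_to_0 (x0 : 'rV[R]_n) : Prop :=
  (forall t, 0 <= t -> J x0 t) /\ (pi t x0 @[t --> +oo] --> (0 : 'rV[R]_n)).

Definition stable : Prop :=
  forall eps : R, 0 < eps -> exists2 delta : R, 0 < delta &
    forall x0, D x0 -> enorm x0 < delta ->
      forall t, 0 <= t -> J x0 t /\ enorm (pi t x0) < eps.

Definition asymptotically_stable : Prop :=
  stable /\ exists2 delta : R, 0 < delta &
    forall x0, D x0 -> enorm x0 < delta -> converges_to_0 x0.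

Definition region_of_attraction : set 'rV[R]_n :=
  [set x0 | D x0 /\ converges_to_0 x0].

End stability.
End dynamics.

Section approximation.
Variables (R : realType) (n : nat) (Omega : set 'rV[R]_n).

Definition class_F (g : 'rV[R]_n -> 'rV[R]_n) : Prop :=
  {within Omega, continuous g} /\ g 0 = 0.

Definition class_V (V : 'rV[R]_n -> R) : Prop :=
  Ck 1 Omega (V : _ -> R^o) /\
  (forall x, Omega x -> (grad V x = 0 <-> x = 0)).

Definition class_P (omega : 'rV[R]_n -> R) : Prop :=
  {within Omega, continuous omega} /\ omega 0 = 0.

Definition vnormC (g : 'rV[R]_n -> 'rV[R]_n) : \bar R :=
  Ck_norm (@enorm R n) 0 Omega g.

Definition snormCk (k : nat) (h : 'rV[R]_n -> R) : \bar R :=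
  Ck_norm (fun y : R^o => `|y|) k Omega h.

Definition jointly_universally_approximating
    (F : set ('rV[R]_n -> 'rV[R]_n)) (V P : set ('rV[R]_n -> R)) : Prop :=
  forall g v omega, class_F g -> class_V v -> class_P omega ->
  forall delta : R, 0 < delta ->
  exists g' v' omega', [/\ F g', V v', P omega' &
    [/\ (vnormC (g \- g')%R <= delta%:E)%E,
        (snormCk 1 (v \- v')%R <= delta%:E)%E &
        (snormCk 0 (omega \- omega')%R <= delta%:E)%E]].

Definition unit_grad (V : 'rV[R]_n -> R) (x : 'rV[R]_n) : 'rV[R]_n :=
  if grad V x == 0 then 0 else (enorm (grad V x))^-1 *: grad V x.

(* With row vectors, v v^T f reads f *m (v^T *m v). *)
Definition generated_model (f : 'rV[R]_n -> 'rV[R]_n)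
    (V omega : 'rV[R]_n -> R) (x : 'rV[R]_n) : 'rV[R]_n :=
  let v := unit_grad V x in
  f x - f x *m (v^T *m v) + (- (omega x * (1 - V x ^+ 2))) *: v.

End approximation.

(* Main.v *)
(* The generated model can reproduce f exactly. Take V x = 2 + |x|^2,
   so that V^2 <> 1 everywhere and grad V x = 2 x vanishes only at 0. With
   v = grad V / |grad V|, the function omega = - (v . f) / (1 - V^2) is continuous because f 0 = 0, and it balances
   the model: f = f - (v . f) v - omega (1 - V^2) v.
   For nearby (f', V', omega') the error of the model is
     (f - f') + (f' . v' + omega' (1 - V'^2)) v',
   and the scalar factor differs from f . v + omega (1 - V^2) = 0 by terms
   controlled by the approximation error, except for f . (v' - v). The latter is
   small near 0 since f is, and elsewhere since |grad V| is bounded below. *)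
Require Import Defs.
From HB Require Import structures.
From mathcomp Require Import all_boot all_order all_algebra.
From mathcomp Require Import all_classical all_reals all_analysis.
From mathcomp Require Import ring lra.
Set Implicit Arguments.
Unset Strict Implicit.
Unset Printing Implicit Defensive.
Import Order.TTheory GRing.Theory Num.Theory.
Import numFieldNormedType.Exports.

Local Open Scope classical_set_scope.
Local Open Scope ring_scope.

(** * Euclidean geometry on row vectors, compared with the max norm *)

Section euclidean.
Variables (R : realType) (n : nat).
Implicit Types x y w : 'rV[R]_n.

Definition dot x y : R := \sum_i x 0 i * y 0 i.
(** Since [0^-1 = 0], the zero vector is sent to itself, which matches the default branch of
    [unit_grad]. *)
Definition normalize w : 'rV[R]_n := (enorm w)^-1 *: w.

Lemma ler_coord_norm x i : `|x 0 i| <= `|x|.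
Proof.
rewrite [leRHS]/Num.Def.normr/= mx_normrE.
by apply/bigmax_geP; right => /=; exists (0, i).
Qed.

Lemma norm_le_coord x (r : R) : 0 <= r -> (forall i, `|x 0 i| <= r) -> `|x| <= r.
Proof.
move=> r0 xr; rewrite [leLHS]/Num.Def.normr/= mx_normrE bigmax_le//= => -[i j] _ /=.
by rewrite ord1.
Qed.

Lemma dotBl x y w : dot (x - y) w = dot x w - dot y w.
Proof. by rewrite -sumrB; apply: eq_bigr => i _; rewrite !mxE mulrBl. Qed.

Lemma dotBr x y w : dot w (x - y) = dot w x - dot w y.
Proof. by rewrite -sumrB; apply: eq_bigr => i _; rewrite !mxE mulrBr. Qed.

(** The norms on the right are max norms, so each of the [n] products is bounded separately;
    Cauchy-Schwarz is avoided at the price of the factor [n]. *)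
Lemma normr_dot x y : `|dot x y| <= n%:R * (`|x| * `|y|).
Proof.
apply: (le_trans (ler_norm_sum _ _ _)).
apply: (@le_trans _ _ (\sum_(i < n) `|x| * `|y|)).
  by apply: ler_sum => i _; rewrite normrM ler_pM// ler_coord_norm.
by rewrite sumr_const card_ord mulr_natl.
Qed.

Lemma mulmx_dot x y : x *m (y^T *m y) = dot x y *: y.
Proof.
rewrite mulmxA [x *m y^T]mx11_scalar mul_scalar_mx mxE; congr (_ *: _).
by apply: eq_bigr => i _; rewrite mxE.
Qed.

Lemma sqr_enorm x : enorm x ^+ 2 = dot x x.
Proof. by rewrite sqr_sqrtr ?sumr_ge0// => i _; rewrite sqr_ge0. Qed.

Lemma enorm_ge0 x : 0 <= enorm x. Proof. exact: sqrtr_ge0. Qed.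

Lemma norm_le_enorm x : `|x| <= enorm x.
Proof.
apply: norm_le_coord; first exact: enorm_ge0.
move=> i; rewrite -sqrtr_sqr ler_wsqrtr// (bigD1 i)//= lerDl sumr_ge0// => j _.
exact: sqr_ge0.
Qed.

Lemma enorm0 : enorm (0 : 'rV[R]_n) = 0.
Proof. by rewrite /enorm big1 ?sqrtr0// => i _; rewrite mxE expr0n. Qed.

Lemma enorm_eq0 x : enorm x = 0 -> x = 0.
Proof. by move=> x0; apply/normr0_eq0/le_anti; rewrite normr_ge0 -x0 norm_le_enorm. Qed.

(** Multiplied by [enorm x + enorm y], the left side becomes a difference of squares, that is, the
    dot product of [x - y] with [x + y], to which [normr_dot] applies. The factor [2 * n] is not
    sharp. *)
Lemma ler_dist_enorm x y : `|enorm x - enorm y| <= 2 * n%:R * `|x - y|.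
Proof.
have [xy0|xy0] := eqVneq (enorm x + enorm y) 0.
  have /enorm_eq0 -> : enorm x = 0.
    by apply/eqP; move/eqP: xy0; rewrite paddr_eq0 ?enorm_ge0// => /andP[].
  have /enorm_eq0 -> : enorm y = 0.
    by apply/eqP; move/eqP: xy0; rewrite paddr_eq0 ?enorm_ge0// => /andP[].
  by rewrite subrr normr0 mulr_ge0// mulr_ge0.
have xy_gt0 : 0 < enorm x + enorm y.
  by rewrite lt_def xy0 addr_ge0 ?enorm_ge0.
rewrite -(ler_pM2r xy_gt0) -{1}(ger0_norm (ltW xy_gt0)) -normrM.
have -> : (enorm x - enorm y) * (enorm x + enorm y) = dot (x - y) x + dot (x - y) y.
  have dotC : dot x y = dot y x by apply: eq_bigr => i _; rewrite mulrC.
  by rewrite !dotBl -!sqr_enorm dotC; ring.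
have := normr_dot (x - y) x; have := normr_dot (x - y) y.
have := norm_le_enorm x; have := norm_le_enorm y.
have := ler_normD (dot (x - y) x) (dot (x - y) y).
have : 0 <= n%:R * `|x - y| :> R by rewrite mulr_ge0.
nra.
Qed.

Lemma enorm_le_norm x : enorm x <= 2 * n%:R * `|x|.
Proof.
by have := ler_dist_enorm x 0; rewrite enorm0 !subr0 ger0_norm// enorm_ge0.
Qed.

Lemma continuous_enorm : continuous (@enorm R n).
Proof.
move=> x; apply/(@cvgrPdist_lt _ _ _ (nbhs x) (nbhs_filter x)) => e e0.
near=> y.
apply: le_lt_trans (ler_dist_enorm _ _) _.
(* The added 1 keeps the divisor positive when [n = 0]. *)
have n0 : (0 : R) < 2 * n%:R + 1 by rewrite ltr_pwDr// mulr_ge0.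
apply: (@le_lt_trans _ _ ((2 * n%:R + 1) * `|x - y|)).
  by rewrite ler_wpM2r// lerDl.
rewrite mulrC -ltr_pdivlMr//.
near: y; have /cvgrPdist_lt : y @[y --> x] --> x by exact: cvg_id.
by apply; exact: divr_gt0.
Unshelve. all: by end_near. Qed.

Lemma norm_normalize_le1 w : `|normalize w| <= 1.
Proof.
rewrite /normalize normrZ normfV (ger0_norm (enorm_ge0 w)).
have [->|w0] := eqVneq (enorm w) 0; first by rewrite invr0 mul0r ler01.
by rewrite ler_pdivrMl ?lt_def ?w0 ?enorm_ge0// mulr1 norm_le_enorm.
Qed.

Lemma unit_gradE (V : 'rV[R]_n -> R) x : unit_grad V x = normalize (grad V x).
Proof.
by rewrite /unit_grad /normalize; case: eqP => // ->; rewrite scaler0.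
Qed.

(** With [u], [u'] the normalized vectors, [enorm w *: (u - u')] equals
    [(w - w') - (enorm w - enorm w') *: u'], and [u'] has norm at most 1. Keeping the factor
    [enorm w] on the left avoids any nonvanishing hypothesis. *)
Lemma dist_normalize w w' :
  `|normalize w - normalize w'| * enorm w <= (2 * n%:R + 1) * `|w - w'|.
Proof.
have [w0|w0] := eqVneq (enorm w) 0.
  by rewrite w0 mulr0 mulr_ge0// addr_ge0// mulr_ge0.
have w_gt0 : 0 < enorm w by rewrite lt_def w0 enorm_ge0.
rewrite -{1}(ger0_norm (enorm_ge0 w)) mulrC -normrZ.
have -> : enorm w *: (normalize w - normalize w') =
    (w - w') - (enorm w - enorm w') *: normalize w'.
  have h : w' = enorm w' *: normalize w'.
    rewrite /normalize scalerA.
    have [/eqP|w'0] := eqVneq (enorm w') 0.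
      by move/eqP/enorm_eq0 ->; rewrite scaler0.
    by rewrite divff// scale1r.
  rewrite [in RHS]scalerBl -h scalerBr {1}/normalize scalerA divff// scale1r.
  by rewrite opprB addrA subrK.
have := ler_normB (w - w') ((enorm w - enorm w') *: normalize w').
rewrite normrZ.
have := ler_dist_enorm w w'; have := norm_normalize_le1 w'.
have := normr_ge0 (enorm w - enorm w'); have := normr_ge0 (normalize w').
nra.
Qed.

End euclidean.

(** * Pointwise bounds extracted from C^k norms *)

Section Ck_norm_bounds.
Variables (R : realType) (n : nat) (W : normedModType R) (N : W -> R).
Variables (A : set 'rV[R]_n) (g : 'rV[R]_n -> W) (e : R).

Lemma multi_partial0 (a : 'I_n -> nat) :
  (forall i, a i = 0%N) -> multi_partial a g = g.
Proof.
by move=> a0; rewrite /multi_partial; elim: (enum _) => //= i s ->; rewrite a0.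
Qed.

(** The enumeration of the indices contains [i] exactly once, and every other index contributes zero
    iterations. *)
Lemma multi_partial1 (i : 'I_n) :
  multi_partial (fun j => (j == i) : nat) g = partial i g.
Proof.
rewrite /multi_partial.
have := mem_enum 'I_n i; rewrite inE; have := enum_uniq 'I_n.
elim: (enum _) => //= j s IH /andP[js us]; rewrite inE eq_sym.
case: eqVneq => [<-{IH us} _|ji /= /IH -> //].
congr partial; elim: s js => //= k s IH; rewrite inE negb_or eq_sym => /andP[ki /IH ->].
by rewrite (negPf ki).
Qed.

(** A multiindex of order at most [k] has all entries at most [k], so it is one of the finite
    functions over which the maximum runs. The base value 0 of that maximum accounts for
    [0 <= e]. *)
Lemma Ck_normP k : 0 <= e ->
  (Ck_norm N k A g <= e%:E)%E <->
  forall (a : 'I_n -> nat) x, (\sum_i a i <= k)%N -> A x ->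
    N (multi_partial a g x) <= e.
Proof.
move=> e0; split=> [/bigmax_leP[_ gle] a x ak Ax|gle].
  have ai i : (a i < k.+1)%N.
    by rewrite ltnS (leq_trans _ ak)// (bigD1 i)//= leq_addr.
  pose b : {ffun 'I_n -> 'I_k.+1} := [ffun i => Ordinal (ai i)].
  have ba i : b i = a i :> nat by rewrite ffunE.
  have : ((N (multi_partial (fun i => b i : nat) g x))%:E <= e%:E)%E.
    apply: le_trans (gle b _); last by under eq_bigr do rewrite ba.
    by apply: ereal_sup_ubound; exists x.
  by rewrite lee_fin (_ : (fun i => b i : nat) = a)//; apply/funext.
apply/bigmax_leP; split; first by rewrite lee_fin.
move=> a ak; apply: ge_ereal_sup => _ [x Ax <-]; rewrite lee_fin.
exact: gle.
Qed.

Lemma Ck_norm0P : 0 <= e ->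
  (Ck_norm N 0 A g <= e%:E)%E <-> forall x, A x -> N (g x) <= e.
Proof.
move=> e0; rewrite Ck_normP//; split=> gle.
  move=> x Ax; have := gle (fun=> 0%N) x; rewrite multi_partial0//; apply=> //.
  by rewrite big1.
move=> a x; rewrite leqn0 sum_nat_eq0 => /forallP a0 Ax.
by rewrite multi_partial0 ?gle// => i; exact/eqP/a0.
Qed.

Lemma Ck_norm1_le : 0 <= e -> (Ck_norm N 1 A g <= e%:E)%E ->
  forall x, A x -> N (g x) <= e /\ forall i, N (partial i g x) <= e.
Proof.
move=> e0 /Ck_normP => /(_ e0) gle x Ax; split.
  by rewrite -(@multi_partial0 (fun=> 0%N))// gle// big1.
move=> i; rewrite -multi_partial1 gle// (bigD1 i)//= eqxx big1// => j ji.
by rewrite (negPf ji).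
Qed.

End Ck_norm_bounds.

(** * Limits of vectors, dot products and normalized vectors *)

Section continuity.
Variables (R : realType) (n : nat) (T : Type) (F : set_system T).
Context {FF : Filter F}.
Implicit Types f g : T -> 'rV[R]_n.

Lemma cvg_rV f (l : 'rV[R]_n) :
  (forall i, f x 0 i @[x --> F] --> l 0 i) -> f @ F --> l.
Proof.
move=> fl; apply/(@cvgrPdist_le _ 'rV[R]_n _ F FF) => e e0.
have : \forall x \near F, forall i, `|l 0 i - f x 0 i| <= e.
  apply: filter_forall => i; move/cvgrPdist_le : (fl i); exact.
apply: filterS => x lf; apply: norm_le_coord; first exact: ltW.
by move=> i; rewrite !mxE.
Qed.

Lemma cvg_dot f g l m :
  f @ F --> l -> g @ F --> m -> dot (f x) (g x) @[x --> F] --> dot l m.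
Proof.
move=> fl gm; rewrite /dot.
apply: cvg_big => [|i _]; first by move=> x; exact: add_continuous.
apply: cvgM; first exact: (cvg_comp _ _ fl (@coord_continuous _ _ _ 0 i l)).
exact: (cvg_comp _ _ gm (@coord_continuous _ _ _ 0 i m)).
Qed.

Lemma cvg_normalize f l :
  enorm l != 0 -> f @ F --> l -> normalize (f x) @[x --> F] --> normalize l.
Proof.
move=> l0 fl; apply: cvgZ => //.
apply: cvgV => //; exact: (cvg_comp _ _ fl (@continuous_enorm _ _ l)).
Qed.

End continuity.

Lemma within_continuousP (T U : topologicalType) (A : set T) (f : T -> U) :
  {within A, continuous f} <->
  forall x, A x -> f y @[y --> within A (nbhs x)] --> f x.
Proof. exact: subspace_continuousP. Qed.

(** * Continuity through the singularity of a normalized field *)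

Section normalized_field.
Variables (R : realType) (n : nat) (A : set 'rV[R]_n) (w : 'rV[R]_n -> 'rV[R]_n).
Hypothesis A0 : A 0.
Hypothesis wc : {within A, continuous w}.
Hypothesis w0 : forall x, A x -> w x = 0 -> x = 0.

(* At 0 the normalized field is merely bounded, which is enough since the other
   factor vanishes there. *)
Lemma scale_normalize_continuous (s : 'rV[R]_n -> R) :
  {within A, continuous s} -> s 0 = 0 ->
  {within A, continuous (fun x => s x *: normalize (w x))}.
Proof.
move=> /within_continuousP sc s0; apply/within_continuousP => x Ax.
have [->|x0] := eqVneq x 0.
  rewrite s0 scale0r.
  apply/(@cvgrPdist_le _ 'rV[R]_n _ (within A (nbhs (0 : 'rV[R]_n)))
    (within_filter _ (nbhs_filter _))) => e e0.
  have /cvgrPdist_le /(_ _ e0) := sc _ A0.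
  apply: filterS => y; rewrite s0 !sub0r !normrN normrZ; apply: le_trans.
  by rewrite ler_piMr// norm_normalize_le1.
apply: cvgZ; first exact: sc.
apply: cvg_normalize; last by move/within_continuousP : wc; exact.
by apply/eqP => /enorm_eq0/(w0 Ax)/eqP; rewrite (negPf x0).
Qed.

(** Away from 0 all operations are continuous; at 0 the dot product is at most [n] times the norm of
    [f], which tends to 0. *)
Lemma dot_normalize_continuous (f : 'rV[R]_n -> 'rV[R]_n) :
  {within A, continuous f} -> f 0 = 0 ->
  {within A, continuous (fun x => dot (f x) (normalize (w x)))}.
Proof.
move=> /within_continuousP fc f0; apply/within_continuousP => x Ax.
have [->|x0] := eqVneq x 0.
  have z y : dot 0 y = 0 :> R by rewrite /dot big1// => i _; rewrite mxE mul0r.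
  rewrite f0 z; apply/cvgrPdist_le => e e0.
  have n0 : (0 : R) < n%:R + 1 by rewrite ltr_wpDl.
  have /(@cvgrPdist_le _ 'rV[R]_n _ (within A (nbhs (0 : 'rV[R]_n)))
    (within_filter _ (nbhs_filter _)))/(_ _ (divr_gt0 e0 n0)) := fc _ A0.
  apply: filterS => y; rewrite f0 !sub0r !normrN ler_pdivlMr// => fy.
  apply: le_trans (normr_dot _ _) _; apply: le_trans fy.
  have := norm_normalize_le1 (w y); have := normr_ge0 (normalize (w y)).
  have := normr_ge0 (f y); have : (0 : R) <= n%:R by [].
  move: (`|f y|) (`|normalize _|) (n%:R) => a b m m0 a0 b0 b1.
  have : 0 <= m * a * (1 - b) by rewrite !mulr_ge0// subr_ge0.
  lra.
apply: cvg_dot; first exact: fc.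
apply: cvg_normalize; last by move/within_continuousP : wc; exact.
by apply/eqP => /enorm_eq0/(w0 Ax)/eqP; rewrite (negPf x0).
Qed.

End normalized_field.

(** * Gradients of C^1 functions *)

Section C1.
Variables (R : realType) (n : nat) (A : set 'rV[R]_n).

Lemma Ck1_derivable (v : 'rV[R]_n -> R) x i :
  Ck 1 A (v : _ -> R^o) -> A x -> derivable (v : _ -> R^o) x (delta_mx 0 i).
Proof. by move=> [U [_ AU [_ /(_ i)[dv _]]]] Ax; exact/dv/AU. Qed.

Lemma Ck1_continuous (v : 'rV[R]_n -> R) :
  Ck 1 A (v : _ -> R^o) -> {within A, continuous v}.
Proof. by move=> [U [_ AU [+ _]]]; exact: continuous_subspaceW. Qed.

Lemma Ck1_grad_continuous (v : 'rV[R]_n -> R) :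
  Ck 1 A (v : _ -> R^o) -> {within A, continuous (grad v)}.
Proof.
move=> [U [_ AU [_ dv]]]; apply: (continuous_subspaceW AU).
apply/within_continuousP => x Ux; apply: cvg_rV => i.
have [_ [/within_continuousP/(_ x Ux) + _]] := dv i.
have -> : (fun y => grad v y 0 i) = partial i (v : _ -> R^o).
  by apply/funext => y; rewrite mxE.
by rewrite mxE.
Qed.

Lemma norm_gradB (u v : 'rV[R]_n -> R) (d : R) x :
  0 <= d -> Ck 1 A (u : _ -> R^o) -> Ck 1 A (v : _ -> R^o) ->
  A x -> (forall i, `|partial i ((u \- v)%R : _ -> R^o) x| <= d) ->
  `|grad u x - grad v x| <= d.
Proof.
move=> d0 uC vC Ax uv; apply: norm_le_coord => // i; rewrite !mxE.
have := uv i; rewrite /partial deriveB//; exact: (@Ck1_derivable _ x).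
Qed.

End C1.

(** * The explicit quadratic Lyapunov candidate *)

Section quadratic.
Variables (R : realType) (n : nat).

Definition quadratic (x : 'rV[R]_n) : R := 2 + dot x x.

Lemma is_derive_quadratic (x : 'rV[R]_n) i :
  is_derive x (delta_mx 0 i) (quadratic : _ -> R^o) (2 * x 0 i).
Proof.
have q : (fun h : R => h^-1 *: (quadratic (h *: delta_mx 0 i + x) - quadratic x) : R^o)
    @ 0^' --> (2 * x 0 i : R^o).
  have <- : 2 * x 0 i + 0 = 2 * x 0 i by rewrite addr0.
  (* Only coordinate [i] moves, so for [h != 0] the difference quotient is exactly
     [2 * x 0 i + h]. *)
  apply: (@cvg_trans _ ((fun h : R => 2 * x 0 i + h : R^o) @ 0^')).
    apply: near_eq_cvg; near=> h.
    have h0 : h != 0 by near: h; exact: nbhs_dnbhs_neq.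
    have -> : quadratic (h *: delta_mx 0 i + x) - quadratic x = h * (2 * x 0 i + h).
      rewrite /quadratic /dot opprD addrACA subrr add0r -sumrB.
      rewrite (bigD1 i)//= !mxE !eqxx/= mulr1 big1 ?addr0.
        by ring.
      by move=> j ji; rewrite !mxE (negPf ji) mulr0 add0r subrr.
    by rewrite /GRing.scale/= mulKf.
  apply: cvgD; first exact: cvg_cst.
  by apply: cvg_within_filter; exact: cvg_id.
apply: DeriveDef; first by apply/cvg_ex; exists (2 * x 0 i).
exact: cvg_lim q.
Unshelve. all: by end_near. Qed.

Lemma grad_quadratic x : grad quadratic x = 2 *: x.
Proof.
apply/rowP => i; rewrite !mxE /partial.
by have /@derive_val -> := is_derive_quadratic x i.
Qed.

Lemma continuous_quadratic : continuous quadratic.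
Proof.
move=> x; apply: (@cvgD _ R^o _ (nbhs x) (nbhs_filter x) (fun=> 2)
  (fun y => dot y y)); first exact: cvg_cst.
by apply: (@cvg_dot R n _ (nbhs x) (nbhs_filter x) id id x x).
Qed.

Lemma class_V_quadratic (A : set 'rV[R]_n) : class_V A quadratic.
Proof.
split; last first.
  move=> x _; rewrite grad_quadratic; split=> [/eqP|->]; last exact: scaler0.
  by rewrite scaler_eq0 pnatr_eq0/= => /eqP.
exists setT; split => //; first exact: openT.
split; first by apply: continuous_subspaceT; exact: continuous_quadratic.
move=> i; split; first by move=> x _; have [] := is_derive_quadratic x i.
split => //; apply: continuous_subspaceT => x.
have -> : partial i (quadratic : _ -> R^o) = (fun x => 2 * x 0 i).
  by apply/funext => y; have /@derive_val := is_derive_quadratic y i.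
apply: (@cvgM _ _ (nbhs x) (nbhs_filter x) (fun=> 2)
  (fun y : 'rV[R]_n => y 0 i)); first exact: cvg_cst.
exact: coord_continuous.
Qed.

End quadratic.

(** * Continuity and error estimates for the generated model *)

Section model.
Variables (R : realType) (n : nat) (A : set 'rV[R]_n).
Implicit Types (f g : 'rV[R]_n -> 'rV[R]_n) (v omega : 'rV[R]_n -> R).

Lemma compact_continuous_bound (U : normedModType R) (h : 'rV[R]_n -> U) :
  compact A -> {within A, continuous h} ->
  exists2 B, 0 <= B & forall x, A x -> `|h x| <= B.
Proof.
move=> cA hc; have [M [_ hM]] := compact_bounded (continuous_compact hc cA).
(* [compact_bounded] provides bounds only for numbers strictly above [M]. *)
exists (`|M| + 1); first by rewrite addr_ge0.
move=> x Ax; apply: hM; last by exists x.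
by rewrite ltr_pwDr// ler_norm.
Qed.

Lemma generated_modelE f v omega x :
  let u := normalize (grad v x) in
  generated_model f v omega x =
  f x - (dot (f x) u + omega x * (1 - v x ^+ 2)) *: u.
Proof.
by rewrite /generated_model unit_gradE mulmx_dot scaleNr scalerDl opprD addrA.
Qed.

(** The model subtracts from [f] a multiple of the unit gradient whose scalar factor vanishes at 0,
    because [f] and [omega] do; the discontinuity of the direction there is thus harmless. *)
Lemma generated_model_continuous f v omega :
  A 0 -> class_F A f -> class_V A v -> class_P A omega ->
  {within A, continuous (generated_model f v omega)}.
Proof.
move=> A0 [fc f0] [vC v0] [oc o0].
have gc := Ck1_grad_continuous vC; have vc := Ck1_continuous vC.
have g0 x : A x -> grad v x = 0 -> x = 0 by move=> /v0[].
have -> : generated_model f v omega = fun x =>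
    f x - (dot (f x) (normalize (grad v x)) + omega x * (1 - v x ^+ 2)) *:
      normalize (grad v x).
  by apply/funext => x; exact: generated_modelE.
apply: within_continuousB => //.
apply: scale_normalize_continuous => //; last first.
  by rewrite f0 o0 mul0r addr0 /dot big1// => i _; rewrite mxE mul0r.
apply: within_continuousD; first exact: dot_normalize_continuous.
apply/within_continuousP => x Ax.
move/within_continuousP/(_ x Ax) in oc; move/within_continuousP/(_ x Ax) in vc.
apply: cvgM => //; apply: cvgB; first exact: cvg_cst.
rewrite expr2; under eq_fun do rewrite expr2.
exact: cvgM.
Qed.

(** In the coefficient of [d], the 2 and [n] collect the errors of [f] (1 and [n]) and a 1 from
    [1 - v' x ^+ 2]; the rest comes from [omega] and [v]. The last summand, the misalignment of the
    directions, is kept apart because it is not bounded by a multiple of [d] uniformly near 0. *)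
Lemma dist_generated_model f g v v' omega omega' x (d K B : R) :
  omega x * (1 - v x ^+ 2) = - dot (f x) (normalize (grad v x)) ->
  d <= 1 -> `|v x| <= K -> `|omega x| <= B ->
  `|f x - g x| <= d -> `|v x - v' x| <= d -> `|omega x - omega' x| <= d ->
  `|f x - generated_model g v' omega' x| <=
    d * (2 + n%:R + (K + 1) ^+ 2 + B * (2 * K + 1)) +
    n%:R * (`|f x| * `|normalize (grad v x) - normalize (grad v' x)|).
Proof.
move=> balance d1 vK oB fg vv oo; rewrite generated_modelE.
set u := normalize (grad v x); set u' := normalize (grad v' x).
rewrite opprB addrCA addrC.
(* By [balance] the factor for the exact triple is zero; subtracting it leaves only differences. *)
have -> : dot (g x) u' + omega' x * (1 - v' x ^+ 2) =
    - dot (f x - g x) u' - dot (f x) (u - u') -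
    ((omega x - omega' x) * (1 - v' x ^+ 2) +
     omega x * ((v' x - v x) * (v' x + v x))).
  move: balance; rewrite dotBl dotBr -/u => balance.
  have -> : dot (f x) u = - (omega x * (1 - v x ^+ 2)) by rewrite balance opprK.
  ring.
apply: le_trans (ler_normD _ _) _; rewrite normrZ.
have u'1 : `|u'| <= 1 by exact: norm_normalize_le1.
set s := - _ - _ - _.
have sle : `|s| <= n%:R * (`|f x - g x| * `|u'|) + n%:R * (`|f x| * `|u - u'|) +
    (d * (1 + (K + 1) ^+ 2) + B * (d * (2 * K + 1))).
  apply: le_trans (ler_normB _ _) _; apply: lerD.
    apply: le_trans (ler_normB _ _) _; rewrite normrN.
    by apply: lerD; exact: normr_dot.
  apply: le_trans (ler_normD _ _) _; rewrite !normrM.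
  (* This is where [d <= 1] enters. *)
  have v'K : `|v' x| <= K + 1.
    have : `|v' x| <= `|v x| + `|v x - v' x|.
      by rewrite -{1}(subKr (v x) (v' x)) ler_normB.
    lra.
  apply: lerD; apply: ler_pM => //.
    apply: le_trans (ler_normB _ _) _; rewrite normr1 lerD2l normrX.
    by rewrite ler_pXn2r ?nnegrE// (le_trans _ v'K).
  apply: ler_pM => //; first by rewrite distrC.
  by apply: le_trans (ler_normD _ _) _; lra.
have : `|s| * `|u'| <= `|s| by rewrite ler_piMr.
have : n%:R * (`|f x - g x| * `|u'|) <= n%:R * d.
  by rewrite ler_wpM2l// -[leRHS]mulr1 ler_pM.
lra.
Qed.

(** Within a radius [r] of 0, [f] is at most [eta / 2] and two normalized vectors differ by at most
    2. Beyond it, [c *: x] has norm at least [c * r], so [dist_normalize] can be divided by it. [C]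
    depends on [eta] but not on [w], so the approximation accuracy can be chosen afterwards. *)
Lemma norm_mul_dist_normalize f (c eta : R) :
  0 < c -> A 0 -> compact A -> {within A, continuous f} -> f 0 = 0 -> 0 < eta ->
  exists2 C, 0 <= C & forall x w, A x ->
    `|f x| * `|normalize (c *: x) - normalize w| <= eta + C * `|c *: x - w|.
Proof.
move=> c0 A0 cA fc f0 eta0.
have [M M0 fM] := compact_continuous_bound cA fc.
have eta2 : 0 < eta / 2 by rewrite divr_gt0.
have [r /= r0 fr] : exists2 r, 0 < r &
    forall x, A x -> `|x| < r -> `|f x| <= eta / 2.
  move/within_continuousP/(_ _ A0) : fc.
  move/(@cvgrPdist_le _ 'rV[R]_n _ (within A (nbhs (0 : 'rV[R]_n)))
    (within_filter _ (nbhs_filter _)))/(_ _ eta2).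
  move=> /nbhs_ballP[r /= r0 fr]; exists r => // x Ax xr.
  have := fr x; rewrite f0 sub0r normrN; apply => //.
  by rewrite -ball_normE/= sub0r normrN.
have cr0 : 0 < c * r by rewrite mulr_gt0.
have n0 : (0 : R) <= 2 * n%:R + 1 by rewrite addr_ge0// mulr_ge0.
(* [M] bounds [f], [2 * n + 1] comes from [dist_normalize], and [c * r] bounds the norm of [c *: x]
   from below. *)
exists (M * (2 * n%:R + 1) / (c * r)).
  by rewrite divr_ge0 ?(ltW cr0)// mulr_ge0.
move=> x w Ax.
set u := normalize (c *: x); set u' := normalize w.
have [xr|rx] := ltP `|x| r.
  have uu : `|u - u'| <= 2.
    by rewrite (le_trans (ler_normB _ _))// lerD// norm_normalize_le1.
  apply: (@le_trans _ _ (eta / 2 * 2)); first by rewrite ler_pM// fr.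
  rewrite divfK// lerDl mulr_ge0// divr_ge0 ?(ltW cr0)//.
  by rewrite mulr_ge0.
apply: (@le_trans _ _ (M * (2 * n%:R + 1) / (c * r) * `|c *: x - w|)); last first.
  by rewrite lerDr ltW.
rewrite -mulrA -mulrA ler_pM ?fM//.
rewrite mulrCA ler_pdivlMl// mulrC.
apply: le_trans (dist_normalize (c *: x) w).
rewrite ler_wpM2l// (le_trans _ (norm_le_enorm _))// normrZ gtr0_norm//.
by rewrite ler_pM2l.
Qed.

End model.

(** * Choice of constants and conclusion *)

Theorem corollary1 (R : realType) (n : nat)
    (D : set 'rV[R]_n) (f : 'rV[R]_n -> 'rV[R]_n)
    (J : 'rV[R]_n -> set R) (pi : R -> 'rV[R]_n -> 'rV[R]_n)
    (Omega : set 'rV[R]_n)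
    (F : set ('rV[R]_n -> 'rV[R]_n)) (V P : set ('rV[R]_n -> R)) :
  is_domain D -> D 0 ->
  {within D, continuous f} -> locally_lipschitz D f -> f 0 = 0 ->
  is_flow D f J pi ->
  asymptotically_stable D J pi ->
  Ck 1 (region_of_attraction D J pi) f ->
  (exists N : set 'rV[R]_n,
     [/\ nbhs (0 : 'rV[R]_n) N, N `<=` region_of_attraction D J pi & Ck 3 N f]) ->
  Hurwitz (jacobian f 0) ->
  compact Omega -> Omega `<=` region_of_attraction D J pi -> Omega 0 ->
  F `<=` class_F Omega -> V `<=` class_V Omega -> P `<=` class_P Omega ->
  jointly_universally_approximating Omega F V P ->
  forall eps : R, 0 < eps ->
  exists f' V' omega', [/\ F f', V V', P omega',
    {within Omega, continuous (generated_model f' V' omega')} &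
    (vnormC Omega (f \- generated_model f' V' omega')%R <= eps%:E)%E].
Proof.
move=> _ _ fD _ f0 _ _ _ _ _ cO OmegaR O0 FO VO PO approx eps eps0.
have fc : {within Omega, continuous f}.
  by apply: continuous_subspaceW fD => x /OmegaR[].
have qV := class_V_quadratic Omega; have [qC1 qgrad] := qV.
have qc := Ck1_continuous qC1.
pose u x := normalize (grad (@quadratic R n) x).
(* Since [quadratic] is at least 2, this quantity is at most -3. *)
have q1 x : 1 - quadratic x ^+ 2 != 0 :> R.
  have : 0 <= dot x x by rewrite -sqr_enorm sqr_ge0.
  by rewrite /quadratic => dx; apply/eqP; nra.
pose omega x := - dot (f x) (u x) / (1 - quadratic x ^+ 2).
have balance x : omega x * (1 - quadratic x ^+ 2) = - dot (f x) (u x).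
  by rewrite /omega divfK.
have omegaP : class_P Omega omega.
  split; last by rewrite /omega f0 /dot big1 ?oppr0 ?mul0r// => i _; rewrite mxE mul0r.
  apply/within_continuousP => x Ox.
  have /within_continuousP/(_ x Ox) dc :
      {within Omega, continuous (fun x => dot (f x) (u x))}.
    apply: dot_normalize_continuous => //; first exact: Ck1_grad_continuous qC1.
    by move=> y /qgrad[].
  move/within_continuousP/(_ x Ox) in qc.
  apply: cvgM; first exact: cvgN.
  apply: cvgV => //; apply: cvgB; first exact: cvg_cst.
  rewrite expr2; under eq_fun do rewrite expr2.
  exact: cvgM.
have [K K0 qK] := compact_continuous_bound cO qc.
have [B B0 oB] := compact_continuous_bound cO omegaP.1.
pose T : R := 2 + n%:R + (K + 1) ^+ 2 + B * (2 * K + 1).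
have T0 : 0 <= T by rewrite !addr_ge0// ?mulr_ge0// ?addr_ge0// mulr_ge0.
(* Chosen so that [2 * n ^ 2 * eta <= eps / 2]: a factor [2 * n] is due to the Euclidean norm,
   another [n] to the dot product. *)
pose eta : R := eps / (4 * (n%:R ^+ 2 + 1)).
have eta0 : 0 < eta.
  by rewrite divr_gt0// mulr_gt0// ltr_wpDl// sqr_ge0.
have [C C0 fu] := norm_mul_dist_normalize (ltr0n R 2) O0 cO fc f0 eta0.
(* The total coefficient of [delta] in the final Euclidean estimate. *)
pose S : R := 2 * n%:R * (T + n%:R * C).
have S0 : 0 <= S by rewrite !mulr_ge0// addr_ge0// mulr_ge0.
(* The bound 1 serves [dist_generated_model]; the other makes [delta * S] at most [eps / 2], with
   [S + 1] guarding against [S = 0]. *)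
pose delta : R := Num.min 1 (eps / (2 * (S + 1))).
have S1 : 0 < 2 * (S + 1) by rewrite mulr_gt0// ltr_wpDl.
have delta0 : 0 < delta by rewrite lt_min ltr01 divr_gt0.
have delta1 : delta <= 1 by rewrite ge_min lexx.
have deltaS : delta * S <= eps / 2.
  have : delta <= eps / (2 * (S + 1)) by rewrite ge_min lexx orbT.
  by rewrite ler_pdivlMr// => h; nra.
have [f' [v' [omega' [Ff' Vv' Po' [df dv dw]]]]] :=
  approx f (@quadratic R n) omega (conj fc f0) qV omegaP delta delta0.
have v'V := VO _ Vv'.
exists f', v', omega'; split => //.
  by apply: generated_model_continuous; [exact: O0|exact: FO| |exact: PO].
apply/Ck_norm0P; first exact: ltW.
move=> x Ox; rewrite /=.
have /(_ x Ox) dfx := (Ck_norm0P _ _ _ (ltW delta0)).1 df.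
have /(_ x Ox) dox := (Ck_norm0P _ _ _ (ltW delta0)).1 dw.
have [dvx dgx] := Ck_norm1_le (ltW delta0) dv Ox.
have dg := norm_gradB (ltW delta0) qC1 v'V.1 Ox dgx.
have := dist_generated_model (balance x) delta1 (qK x Ox) (oB x Ox)
  (le_trans (norm_le_enorm _) dfx) dvx dox.
(* The vector [2 *: x] is the gradient of [quadratic], which is why [c = 2] was taken. *)
have := fu x (grad v' x) Ox; rewrite -grad_quadratic => fux.
rewrite -/T => dist.
apply: le_trans (enorm_le_norm _) _.
have n0 : (0 : R) <= 2 * n%:R by rewrite mulr_ge0.
apply: (@le_trans _ _ (2 * n%:R * (delta * T + n%:R * (eta + C * delta)))).
  rewrite ler_wpM2l// (le_trans dist)// lerD2l ler_wpM2l// (le_trans fux)// lerD2l.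
  by rewrite ler_wpM2l.
have -> : 2 * n%:R * (delta * T + n%:R * (eta + C * delta)) =
    delta * S + 2 * n%:R ^+ 2 * eta by rewrite /S; ring.
suff : 2 * n%:R ^+ 2 * eta <= eps / 2 by lra.
rewrite /eta mulrA ler_pdivrMr; last by rewrite mulr_gt0// ltr_wpDl// sqr_ge0.
have : 0 <= n%:R ^+ 2 :> R by exact: sqr_ge0.
nra.
Qed.
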